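(* Let $p \geq 1$ and $n \geq 2$ be integers. The maximum value of $\sum_{i=1}^n x_i^{2p+1}$ over all $(x_1,\dots,x_n)\in\mathbb{R}^n$ satisfying $\sum_{i=1}^n x_i^2 = 1$ and $\sum_{i=1}^n x_i = 0$ is attained at the point with $x_1 = \sqrt{\frac{n-1}{n}}$ and $x_j = -\sqrt{\frac{1}{(n-1)n}}$ for $j = 2,\dots,n$, and the value of this maximum is $$\frac{(n-1)^{2p}-1}{n^{p+1/2}(n-1)^{p-1/2}}.$$ *)

(* Defs.v *)
From HB Require Import structures.
From mathcomp Require Import all_boot all_order all_algebra.
From mathcomp Require Import boolp classical_sets reals exp.

Set Implicit Arguments.
Unset Strict Implicit.
Unset Printing Implicit Defensive.

Import Order.TTheory GRing.Theory Num.Theory.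

Local Open Scope classical_set_scope.
Local Open Scope ring_scope.

Definition power_sum (R : realType) (n k : nat) (x : 'rV[R]_n) : R :=
  \sum_(i < n) x ord0 i ^+ k.

Definition sphere_sum0 (R : realType) (n : nat) : set 'rV[R]_n :=
  [set x | \sum_(i < n) x ord0 i ^+ 2 = 1 /\ \sum_(i < n) x ord0 i = 0].

(* Coordinates are indexed from 0, so the distinguished coordinate x_1 is the
   one whose index has value 0. *)
Definition extremal_point (R : realType) (n : nat) : 'rV[R]_n :=
  \row_(i < n) if val i == 0%N then Num.sqrt ((n%:R - 1) / n%:R)
               else - Num.sqrt (1 / ((n%:R - 1) * n%:R)).

Definition max_attained_at (R : realType) (T : Type) (f : T -> R) (D : set T)
    (a : T) : Prop :=
  D a /\ forall x, D x -> f x <= f a.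

(* Main.v *)
(** The point [e] of the theorem has coordinates [a] (once) and [y = - b]
    ([n - 1] times), with [a = (n - 1) b].  Let [q] be the quadratic polynomial
    that interpolates [t ^ (2p+1)] at [a] and, to second order, at [y].  Then
    [q t - t ^ (2p+1) = (t - y)^2 * (G a - G t)], where [G] is the second-order
    Taylor quotient of [t ^ (2p+1)] at [y], a polynomial of odd degree whose
    derivative is nonnegative on the whole line; hence [t ^ (2p+1) <= q t] for
    all [t <= a].  The constraints force every coordinate to be at most [a]
    (Cauchy-Schwarz) and they determine [\sum_i q (x_i)]; summing the
    inequality over the coordinates gives the bound, which is an equality at
    [e] because the coordinates of [e] are contact points. *)
Require Import Defs.
From mathcomp Require Import all_boot all_order all_algebra.
From mathcomp Require Import boolp classical_sets reals exp.
From mathcomp Require Import polyrcf ring lra.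
Import Order.TTheory GRing.Theory Num.Theory.
Local Open Scope ring_scope.

(* With [c] concave, each mixed term [c (2i+1) y^(2i+1) t^(...)] is absorbed by
   half a square [(t + y)^2]; the left-hand side is the leftover of the last
   even term. *)
Lemma concave_binary_form_ge {R : realFieldType} (c : nat -> R) (t y : R)
    (n : nat) :
    c 1%N <= 2 * c 0%N ->
    (forall i, c (2 * i + 1)%N + c (2 * i + 3)%N <= 2 * c (2 * i + 2)%N) ->
    (forall i, (i < n)%N -> 0 <= c (2 * i + 1)%N) ->
  c (2 * n + 1)%N / 2 * y ^+ (2 * n) <=
    \sum_(j < (2 * n).+1) c j * y ^+ j * t ^+ (2 * n - j).
Proof.
move=> c0 cc; elim: n => [|n IHn] cpos.
  rewrite muln0 big_ord_recl big_ord0 /= !expr0 !mulr1 addr0 add0n; lra.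
have {}IHn := IHn (fun i ltin => cpos i (ltnW ltin)).
have -> : (2 * n.+1 = (2 * n).+2)%N by rewrite mulnS.
rewrite big_ord_recr big_ord_recr /= subnn subSnn expr0 expr1 mulr1.
under eq_bigr => j _.
  have -> : ((2 * n).+2 - j = (2 * n - j) + 2)%N.
    have lejn : (j <= 2 * n)%N by rewrite -ltnS.
    by rewrite addn2 !subSn // leqW.
  rewrite exprD mulrA; over.
rewrite -mulr_suml.
set V := (\sum_(i < _) _) in IHn *.
have cn := cpos n (ltnSn n); have ccn := cc n.
rewrite (_ : ((2 * n).+2 + 1 = 2 * n + 3)%N); last by rewrite addn3 addn1.
rewrite addn1 addn3 addn2 in cn ccn IHn *.
have yn : 0 <= y ^+ (2 * n) by rewrite exprM exprn_ge0 ?sqr_ge0.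
move: (y ^+ (2 * n)) yn IHn (exprS y (2 * n)) (exprS y (2 * n).+1) => Y Y0 IHn.
move=> -> ->.
have tt : 0 <= t ^+ 2 by exact: sqr_ge0.
have h1 := ler_wpM2r tt IHn.
have h2 : 0 <= c (2 * n).+1 * (Y * (t + y) ^+ 2).
  by rewrite mulr_ge0 // mulr_ge0 ?sqr_ge0.
have h3 := ler_wpM2r (mulr_ge0 Y0 (sqr_ge0 y)) ccn.
rewrite !expr2 in h1 h2 h3 *; nra.
Qed.

(** The quotient of ['X^n.+2] minus its tangent line at [y] by the square of ['X - y]; the index [n]
    is the degree of the quotient, two less than the power. *)
Definition taylor_quot {R : nzRingType} (y : R) (n : nat) : {poly R} :=
  \sum_(j < n.+1) (j.+1%:R * y ^+ j) *: 'X^(n - j).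

Lemma taylor_quotE {R : comNzRingType} (y t : R) (n : nat) :
  t ^+ n.+2 =
    y ^+ n.+2 + n.+2%:R * y ^+ n.+1 * (t - y) +
    (taylor_quot y n).[t] * (t - y) ^+ 2.
Proof.
elim: n => [|n IHn].
  have -> : (taylor_quot y 0).[t] = 1.
    by rewrite /taylor_quot big_ord1 !hornerE.
  ring.
(* Horner-type recursion: multiplying the identity for [n] by [t] produces exactly this new constant
   term. *)
have -> : (taylor_quot y n.+1).[t] =
    t * (taylor_quot y n).[t] + n.+2%:R * y ^+ n.+1.
  rewrite /taylor_quot big_ord_recr /= hornerD hornerZ subnn hornerC mulr1.
  congr (_ + _); rewrite !horner_sum mulr_sumr; apply: eq_bigr => j _.
  have lejn : (j <= n)%N by rewrite -ltnS.
  by rewrite !hornerZ !hornerXn subSn // exprS mulrCA.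
rewrite exprS IHn !exprS -!natr1; ring.
Qed.

(** The derivative is a binary form of even degree [2 * n] in [t] and [y], whose coefficients
    [(j + 1) (2n + 1 - j)] are concave in [j] and vanish at [j = 2n + 1], so the lower bound of
    [concave_binary_form_ge] is zero. *)
Lemma taylor_quot_deriv_ge0 {R : realFieldType} (y t : R) (n : nat) :
  0 <= (taylor_quot y (2 * n).+1)^`().[t].
Proof.
pose c (j : nat) : R := j.+1%:R * ((2 * n).+1%:R - j%:R).
have -> : (taylor_quot y (2 * n).+1)^`().[t] =
    \sum_(j < (2 * n).+1) c j * y ^+ j * t ^+ (2 * n - j).
  rewrite /taylor_quot big_ord_recr /= subnn expr0 derivD derivZ derivC scaler0.
  rewrite addr0 raddf_sum horner_sum /=; apply: eq_bigr => j _.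
  have lejn : (j <= 2 * n)%N by rewrite -ltnS.
  rewrite derivZ derivXn subSn //= hornerZ hornerMn hornerXn /c -mulr_natl.
  by rewrite -natrB ?subSn // ?leqW //; ring.
have c_end : c (2 * n + 1)%N = 0 by rewrite /c addn1 subrr mulr0.
apply: le_trans (concave_binary_form_ge c t y n _ _ _) => [||i|i ltin].
- by rewrite c_end !mul0r.
- have := ler0n R (2 * n); rewrite /c -!natr1; lra.
- rewrite /c !addn1 !addn2 !addn3 -!natr1; lra.
- by rewrite mulr_ge0 // subr_ge0 ler_nat addn1 ltnS leq_mul2l ltnW.
Qed.

Lemma taylor_quot_homo {R : rcfType} (y : R) (n : nat) :
  {homo horner (taylor_quot y (2 * n).+1) : s t / s <= t}.
Proof.
move=> s t; rewrite le_eqVlt => /predU1P[->//|ltst].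
have [u _ E] := poly_mvt (taylor_quot y (2 * n).+1) ltst.
by rewrite -subr_ge0 E mulr_ge0 ?taylor_quot_deriv_ge0 // subr_ge0 ltW.
Qed.

Lemma odd_power_le_quadratic {R : rcfType} (y a t : R) (n : nat) : t <= a ->
  t ^+ (2 * n).+3 <=
    y ^+ (2 * n).+3 + (2 * n).+3%:R * y ^+ (2 * n).+2 * (t - y) +
    (taylor_quot y (2 * n).+1).[a] * (t - y) ^+ 2.
Proof.
move=> leta; rewrite [leLHS](taylor_quotE y) lerD2l ler_wpM2r ?sqr_ge0 //.
exact: taylor_quot_homo.
Qed.

Section ExtremalPoint.
Context {R : realType} (m : nat).
Local Notation n := m.+2.

Let a : R := Num.sqrt ((n%:R - 1) / n%:R).
Let b : R := Num.sqrt (1 / ((n%:R - 1) * n%:R)).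

(** The constraints fix the first two moments, so the sum is the same at every feasible point; this
    allows [x] to be traded for the extremal point. *)
Lemma sphere_sum0_quadratic (x : 'rV[R]_n) (u v w y : R) :
    sphere_sum0 x ->
  \sum_(i < n) (u + v * (x ord0 i - y) + w * (x ord0 i - y) ^+ 2) =
    n%:R * (u - v * y + w * y ^+ 2) + w.
Proof.
move=> [x2 x1]; move defC : (u - v * y + w * y ^+ 2) => C.
under eq_bigr => i _.
  rewrite (_ : _ + _ = C + (v - 2 * w * y) * x ord0 i + w * x ord0 i ^+ 2);
    last by rewrite -defC; ring.
  over.
rewrite !big_split /= sumr_const card_ord -!mulr_sumr x2 x1 -(mulr_natl C); ring.
Qed.

Lemma sphere_sum0_le (x : 'rV[R]_n) (i : 'I_n) :
  sphere_sum0 x -> x ord0 i <= a.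
Proof.
move=> [x2 x1]; apply: le_trans (ler_norm _) _.
rewrite -sqrtr_sqr ler_wsqrtr //.
move: x2 x1; rewrite (bigD1 i) //= [in X in _ -> X -> _](bigD1 i) //=.
set t := x ord0 i => x2 x1.
have card : \sum_(j < n | j != i) (1 : R) = m.+1%:R.
  by rewrite sumr_const cardC1 card_ord.
(* With [M = m.+1], the other coordinates have mean [- t / M]; this is their scaled variance, equal
   to [M (M - t^2 (M + 1))], whence [t^2 <= M / (M + 1)]. *)
have : 0 <= \sum_(j < n | j != i) (m.+1%:R * x ord0 j + t) ^+ 2.
  by apply: sumr_ge0 => j _; rewrite sqr_ge0.
under eq_bigr => j _.
  rewrite (_ : _ ^+ 2 = m.+1%:R ^+ 2 * x ord0 j ^+ 2 +
    2 * m.+1%:R * t * x ord0 j + t ^+ 2 * 1); last by ring.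
  over.
rewrite !big_split /= -!mulr_sumr card.
have -> : \sum_(j < n | j != i) x ord0 j ^+ 2 = 1 - t ^+ 2 by rewrite -x2; ring.
have -> : \sum_(j < n | j != i) x ord0 j = - t.
  by apply/eqP; rewrite -addr_eq0 addrC x1.
have -> : n%:R - 1 = m.+1%:R :> R by rewrite -natr1 addrK.
have -> : n%:R = m.+1%:R + 1 :> R by rewrite natr1.
have : 0 < m.+1%:R :> R by rewrite ltr0n.
move: (m.+1%:R : R) => M M0.
rewrite ler_pdivlMr ?addr_gt0 // (_ : _ + _ = M * (M - t ^+ 2 * (M + 1))).
  by rewrite pmulr_rge0 // subr_ge0.
ring.
Qed.

Lemma extremal_point_coord (i : 'I_n) :
  extremal_point R n ord0 i = if i == ord0 then a else - b.
Proof. by rewrite mxE. Qed.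

Lemma sum_extremal_point (f : R -> R) :
  \sum_(i < n) f (extremal_point R n ord0 i) = f a + m.+1%:R * f (- b).
Proof.
rewrite big_ord_recl extremal_point_coord eqxx; congr (_ + _).
under eq_bigr => i _ do rewrite extremal_point_coord /=.
by rewrite sumr_const card_ord mulr_natl.
Qed.

Lemma extremal_point_ratio : a = m.+1%:R * b.
Proof.
have M0 : 0 < m.+1%:R :> R by rewrite ltr0n.
rewrite /a /b (_ : n%:R - 1 = m.+1%:R :> R); last by rewrite -natr1 addrK.
rewrite -[X in X * Num.sqrt _](ger0_norm (ltW M0)) -sqrtr_sqr -sqrtrM ?sqr_ge0 //.
by congr Num.sqrt; field; rewrite -natrD nat1r !pnatr_eq0.
Qed.

Lemma extremal_point_small_sqr : b ^+ 2 = (m.+1%:R * n%:R)^-1.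
Proof.
rewrite /b (_ : n%:R - 1 = m.+1%:R :> R); last by rewrite -natr1 addrK.
by rewrite sqr_sqrtr mul1r // invr_ge0 mulr_ge0.
Qed.

Lemma extremal_point_sphere_sum0 : sphere_sum0 (extremal_point R n).
Proof.
split.
  rewrite (sum_extremal_point (fun t => t ^+ 2)) sqrrN extremal_point_ratio.
  rewrite exprMn extremal_point_small_sqr; field.
  by rewrite -natrD nat1r !pnatr_eq0.
by rewrite (sum_extremal_point id) /= extremal_point_ratio mulrN subrr.
Qed.

Lemma power_sum_extremal_point (p : nat) :
  power_sum (2 * p + 1) (extremal_point R n) =
    ((n%:R - 1) ^+ (2 * p) - 1) /
    (n%:R `^ (p%:R + 1 / 2) * (n%:R - 1) `^ (p%:R - 1 / 2)).
Proof.
rewrite /power_sum (sum_extremal_point (fun t => t ^+ (2 * p + 1))).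
rewrite extremal_point_ratio.
have M0 : 0 < m.+1%:R :> R by rewrite ltr0n.
have N0 : 0 < n%:R :> R by rewrite ltr0n.
(* Since [b ^+ 2] is rational in [n], only one factor [b] keeps its square root. *)
have b2p : b ^+ (2 * p + 1) = b / (m.+1%:R ^+ p * n%:R ^+ p).
  by rewrite addn1 exprS exprM extremal_point_small_sqr exprVn exprMn.
have -> : (- b) ^+ (2 * p + 1) = - b ^+ (2 * p + 1).
  by rewrite -[LHS]mulr1 exprNn addn1 exprS exprM sqrrN !expr1n; ring.
rewrite exprMn b2p /b (_ : n%:R - 1 = m.+1%:R :> R); last by rewrite -natr1 addrK.
have M1 : m.+1%:R != 0 :> R by rewrite gt_eqF.
have N1 : n%:R != 0 :> R by rewrite gt_eqF.
rewrite powRB ?M1 ?implybT // powRD ?N1 ?implybT //.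
rewrite !powR_mulrn ?ltW // !mul1r !powR12_sqrt ?ltW //.
rewrite sqrtrV ?mulr_ge0 // sqrtrM ?ltW //.
have sM : Num.sqrt m.+1%:R ^+ 2 = m.+1%:R :> R by rewrite sqr_sqrtr ?ltW.
have sM0 : Num.sqrt m.+1%:R != 0 :> R by rewrite gt_eqF ?sqrtr_gt0.
have sN0 : Num.sqrt n%:R != 0 :> R by rewrite gt_eqF ?sqrtr_gt0.
have Mp : m.+1%:R ^+ p != 0 :> R by exact: expf_neq0.
have Np : n%:R ^+ p != 0 :> R by exact: expf_neq0.
rewrite addn1 exprS; move: (m.+1%:R ^+ (2 * p)) => Q.
move: (m.+1%:R ^+ p) Mp (n%:R ^+ p) Np (Num.sqrt n%:R) sN0 => A A0 B B0 s s0.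
(* Outside the roots, [m.+1%:R] becomes the square of its root, leaving [field] a rational identity
   in that root. *)
rewrite -{1 3}sM; field.
by rewrite sM0 A0 s0 B0.
Qed.

Lemma extremal_point_max (p : nat) :
  max_attained_at (@power_sum R n (2 * p).+3) (@sphere_sum0 R n)
    (extremal_point R n).
Proof.
split; first exact: extremal_point_sphere_sum0.
move=> x xD; rewrite /power_sum.
have bound i := odd_power_le_quadratic (- b) _ _ p (sphere_sum0_le x i xD).
apply: le_trans (ler_sum _ (fun i _ => bound i)) _.
(* The quadratic has the same sum at [x] and at the extremal point. *)
rewrite sphere_sum0_quadratic // -(sphere_sum0_quadratic (extremal_point R n));
  last exact: extremal_point_sphere_sum0.
apply: ler_sum => i _; rewrite extremal_point_coord.
(* Contact at [a] is the Taylor identity evaluated there; at [- b] the linear and quadratic terms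
   vanish. *)
case: ifP => _; first by rewrite -taylor_quotE.
by rewrite subrr expr0n !mulr0 !addr0.
Qed.

End ExtremalPoint.

Theorem theorem3 (R : realType) (p n : nat) (hp : (1 <= p)%N) (hn : (2 <= n)%N) :
  max_attained_at (@power_sum R n (2 * p + 1)) (@sphere_sum0 R n)
    (extremal_point R n) /\
  power_sum (2 * p + 1) (extremal_point R n) =
    ((n%:R - 1) ^+ (2 * p) - 1) /
    (n%:R `^ (p%:R + 1 / 2) * (n%:R - 1) `^ (p%:R - 1 / 2)).
Proof.
case: n hn => [|[|m]] // _; split; last exact: power_sum_extremal_point.
(* Shifting [p] by one turns the exponent into [(2 * p).+3], for which the Taylor quotient has odd
   degree [(2 * p).+1]. *)
case: p hp => // p _.
by rewrite addn1 mulnS; exact: extremal_point_max.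
Qed.
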